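(* Let $n\in\mathbb{N}$ and $\mathcal{CS}_n(\mathbb{R})=\{S\in M_n(\mathbb{R}): S^*=-S,\ \|S\|\le1\}$. (i) If $n$ is odd, then $$C^*\text{-}ext(\mathcal{CS}_n(\mathbb{R}))=\Big\{S\in\mathcal{CS}_n(\mathbb{R}): S\sim 0\oplus\begin{bmatrix}0&I_{\frac{n-1}{2}}\\-I_{\frac{n-1}{2}}&0\end{bmatrix}\Big\}.$$ (ii) If $n$ is even, then $$C^*\text{-}ext(\mathcal{CS}_n(\mathbb{R}))=\Big\{S\in\mathcal{CS}_n(\mathbb{R}): S\sim\begin{bmatrix}0&I_{\frac{n}{2}}\\-I_{\frac{n}{2}}&0\end{bmatrix}\Big\},$$ which is precisely the set of all skew-symmetric unitary (i.e. real orthogonal) matrices in $M_n(\mathbb{R})$.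
   Context: For a real matrix, $S^*$ is the transpose and $\|S\|$ the operator norm; unitary in $M_n(\mathbb{R})$ means real orthogonal. $S\sim S'$ means $S'=U^*SU$ for some unitary $U\in M_n(\mathbb{R})$. In (i), $0$ denotes the $1\times1$ zero block. $C^*\text{-}ext(\mathcal{CS}_n(\mathbb{R}))$ is the set of $C^*$-extreme points of the $C^*$-convex set $\mathcal{CS}_n(\mathbb{R})$: $S\in\mathcal{CS}_n(\mathbb{R})$ is $C^*$-extreme if whenever $S=\sum_{j=1}^kT_j^*S_jT_j$ with $S_j\in\mathcal{CS}_n(\mathbb{R})$ and invertible $T_j\in M_n(\mathbb{R})$ such that $\sum_{j=1}^kT_j^*T_j=I_n$, then $S_j\sim S$ for all $j$. *)

(* Defs.v *)
From HB Require Import structures.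
From mathcomp Require Import all_boot all_order all_algebra.
From mathcomp Require Import all_classical all_reals.

Set Implicit Arguments.
Unset Strict Implicit.
Unset Printing Implicit Defensive.

Import Order.TTheory GRing.Theory Num.Theory.
Local Open Scope classical_set_scope.
Local Open Scope ring_scope.

(* The library norm on matrices is the max norm, hence a separate Euclidean
   norm and its induced operator norm. *)
Definition l2norm (R : realType) (n : nat) (x : 'cV[R]_n) : R :=
  Num.sqrt (\sum_i x i 0 ^+ 2).

(* The set below contains 0 and is bounded above, so [sup] does not take its
   default value. *)
Definition opnorm (R : realType) (n : nat) (S : 'M[R]_n) : R :=
  sup [set l2norm (S *m x) | x in [set x : 'cV[R]_n | l2norm x <= 1]].

Definition orthogonal_matrix (R : realType) (n : nat) (U : 'M[R]_n) : Prop :=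
  U^T *m U = 1%:M /\ U *m U^T = 1%:M.

Definition orthogonally_similar (R : realType) (n : nat) (S S' : 'M[R]_n) :
    Prop :=
  exists U : 'M[R]_n, orthogonal_matrix U /\ S' = U^T *m S *m U.

Definition CS (R : realType) (n : nat) : set 'M[R]_n :=
  [set S | S^T = - S /\ opnorm S <= 1].

Definition cstar_extreme (R : realType) (n : nat) (K : set 'M[R]_n) :
    set 'M[R]_n :=
  [set S | K S /\
    forall (k : nat) (T Sj : 'I_k -> 'M[R]_n),
      (forall j, K (Sj j)) ->
      (forall j, T j \in unitmx) ->
      \sum_(j < k) (T j)^T *m T j = 1%:M ->
      S = \sum_(j < k) (T j)^T *m Sj j *m T j ->
      forall j, orthogonally_similar (Sj j) S].

Definition symplectic_block (R : realType) (m : nat) : 'M[R]_(m + m) :=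
  block_mx 0 1%:M (- 1%:M) 0.

Lemma even_size (n : nat) : ~~ odd n -> (n./2 + n./2)%N = n.
Proof. by move=> /even_halfK; rewrite addnn. Qed.

Lemma odd_size (n : nat) : odd n -> (1 + (n.-1./2 + n.-1./2))%N = n.
Proof. by case: n => // n /= /even_halfK; rewrite addnn add1n => ->. Qed.

Definition even_model (R : realType) (n : nat) (n_even : ~~ odd n) : 'M[R]_n :=
  castmx (even_size n_even, even_size n_even) (symplectic_block R n./2).

Definition odd_model (R : realType) (n : nat) (n_odd : odd n) : 'M[R]_n :=
  castmx (odd_size n_odd, odd_size n_odd)
    (block_mx (0 : 'M[R]_1) 0 0 (symplectic_block R n.-1./2)).

(* Main.v *)
(* A C*-extreme point S of CS_n is in particular not the midpoint of a segment
   [S - E, S + E] of CS_n. Taking E = (S + S^3)/2 gives S^3 = -S: for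
   y = x + S^2 x one has |x|^2 - |(S + E) x|^2 = |y|^2 - |S y|^2 / 4. Taking
   E = u v^T - v u^T with u, v orthonormal in ker S shows dim ker S <= 1.
   Conversely, suppose S^3 = -S, dim ker S <= 1 and S = sum_j T_j^T S_j T_j.
   S is isometric on its range, so equality in the Cauchy-Schwarz inequality
   forces S_j T_j S = T_j S^2. Hence S_j^3 + S_j, which is skew-symmetric,
   vanishes on the range of T_j S, so it has rank at most 1 and is zero. Finally,
   S^3 = -S and dim ker S <= 1 characterize the orbit of the model: an
   orthonormal basis of pairs x, -S x is built greedily. *)
Require Import Defs.
From HB Require Import structures.
From mathcomp Require Import all_boot all_order all_algebra.
From mathcomp Require Import all_classical all_reals.
From mathcomp Require Import ring lra zify.

Set Implicit Arguments.
Unset Strict Implicit.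
Unset Printing Implicit Defensive.

Import Order.TTheory GRing.Theory Num.Theory.
Local Open Scope classical_set_scope.
Local Open Scope ring_scope.

(** * Euclidean inner product and operator norm *)

Definition dot (R : realType) (n : nat) (x y : 'cV[R]_n) : R := (x^T *m y) 0 0.

Lemma dotE (R : realType) (n : nat) (x y : 'cV[R]_n) :
  dot x y = \sum_i x i 0 * y i 0.
Proof. by rewrite /dot mxE; apply: eq_bigr => i _; rewrite mxE. Qed.

Lemma dotC (R : realType) (n : nat) (x y : 'cV[R]_n) : dot x y = dot y x.
Proof. by rewrite !dotE; apply: eq_bigr => i _; rewrite mulrC. Qed.

Lemma dot0r (R : realType) (n : nat) (x : 'cV[R]_n) : dot x 0 = 0.
Proof. by rewrite /dot mulmx0 mxE. Qed.

Lemma dotDr (R : realType) (n : nat) (x y z : 'cV[R]_n) :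
  dot x (y + z) = dot x y + dot x z.
Proof. by rewrite /dot mulmxDr mxE. Qed.

Lemma dotDl (R : realType) (n : nat) (x y z : 'cV[R]_n) :
  dot (y + z) x = dot y x + dot z x.
Proof. by rewrite dotC dotDr !(dotC x). Qed.

Lemma dotZr (R : realType) (n : nat) (a : R) (x y : 'cV[R]_n) :
  dot x (a *: y) = a * dot x y.
Proof. by rewrite /dot -scalemxAr mxE. Qed.

Lemma dotZl (R : realType) (n : nat) (a : R) (x y : 'cV[R]_n) :
  dot (a *: x) y = a * dot x y.
Proof. by rewrite dotC dotZr dotC. Qed.

Lemma dotNr (R : realType) (n : nat) (x y : 'cV[R]_n) :
  dot x (- y) = - dot x y.
Proof. by rewrite -scaleN1r dotZr mulN1r. Qed.

Lemma dotNl (R : realType) (n : nat) (x y : 'cV[R]_n) :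
  dot (- x) y = - dot x y.
Proof. by rewrite dotC dotNr dotC. Qed.

Definition dot_linE := (dotDr, dotDl, dotNr, dotNl, dotZr, dotZl).

Lemma dot_sumr (R : realType) (n k : nat) (x : 'cV[R]_n) (F : 'I_k -> 'cV[R]_n) :
  dot x (\sum_j F j) = \sum_j dot x (F j).
Proof. by rewrite /dot mulmx_sumr summxE. Qed.

Lemma dot_mull (R : realType) (m n : nat) (A : 'M[R]_(m, n)) x y :
  dot (A *m x) y = dot x (A^T *m y).
Proof. by rewrite /dot trmx_mul mulmxA. Qed.

Lemma dot_skewl (R : realType) (n : nat) (S : 'M[R]_n) x y :
  S^T = - S -> dot (S *m x) y = - dot x (S *m y).
Proof. by move=> SN; rewrite dot_mull SN mulNmx dotNr. Qed.

Lemma dot_ge0 (R : realType) (n : nat) (x : 'cV[R]_n) : 0 <= dot x x.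
Proof. by rewrite dotE; apply: sumr_ge0 => i _; rewrite -expr2 sqr_ge0. Qed.

Lemma dot_eq0 (R : realType) (n : nat) (x : 'cV[R]_n) : dot x x = 0 -> x = 0.
Proof.
rewrite dotE => /eqP; rewrite psumr_eq0; last by move=> i _; rewrite -expr2 sqr_ge0.
move=> /allP x0; apply/colP => i; rewrite mxE.
by have /(_ (mem_index_enum i)) := x0 i; rewrite mulf_eq0 orbb => /eqP.
Qed.

Lemma skew_dot0 (R : realType) (n : nat) (S : 'M[R]_n) x :
  S^T = - S -> dot x (S *m x) = 0.
Proof. by move=> SN; have := dot_skewl x x SN; rewrite dotC; lra. Qed.

Lemma l2norm_sqr (R : realType) (n : nat) (x : 'cV[R]_n) : l2norm x ^+ 2 = dot x x.
Proof.
rewrite /l2norm sqr_sqrtr ?dotE; last by apply: sumr_ge0 => i _; rewrite sqr_ge0.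
by apply: eq_bigr => i _; rewrite expr2.
Qed.

Lemma l2norm_ge0 (R : realType) (n : nat) (x : 'cV[R]_n) : 0 <= l2norm x.
Proof. exact: sqrtr_ge0. Qed.

Lemma l2norm_le (R : realType) (m n : nat) (x : 'cV[R]_m) (y : 'cV[R]_n) :
  (l2norm x <= l2norm y) = (dot x x <= dot y y).
Proof. by rewrite -!l2norm_sqr ler_pXn2r // nnegrE l2norm_ge0. Qed.

Lemma l2norm_le1 (R : realType) (n : nat) (x : 'cV[R]_n) :
  (l2norm x <= 1) = (dot x x <= 1).
Proof. by rewrite -l2norm_sqr expr_le1 ?l2norm_ge0. Qed.

Lemma opnorm_has_ubound (R : realType) (n : nat) (S : 'M[R]_n) :
  has_ubound [set l2norm (S *m x) | x in [set x : 'cV[R]_n | l2norm x <= 1]].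
Proof.
(* Coordinates of a vector in the unit ball are at most 1 in absolute value, so the [i]-th
   coordinate of [S *m x] is bounded by the absolute sum of row [i]. *)
exists (Num.sqrt (\sum_i (\sum_j `|S i j|) ^+ 2)) => _ [x /= x1 <-].
apply: ler_wsqrtr; apply: ler_sum => i _.
rewrite -real_normK ?num_real //.
rewrite ler_pXn2r ?nnegrE ?sumr_ge0 // mxE (le_trans (ler_norm_sum _ _ _))//.
apply: ler_sum => j _; rewrite normrM ler_piMr //.
rewrite -(@expr_le1 _ 2) // real_normK ?num_real //.
move: x1; rewrite l2norm_le1 dotE; apply: le_trans.
rewrite (bigD1 j) //= -expr2 lerDl.
by apply: sumr_ge0 => k _; rewrite -expr2 sqr_ge0.
Qed.

(** Squared, pointwise form of the norm bound: free of suprema and roots, it leaves polynomial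
    inequalities between inner products. *)
Definition contraction (R : realType) (n : nat) (S : 'M[R]_n) : Prop :=
  forall x : 'cV[R]_n, dot (S *m x) (S *m x) <= dot x x.

Lemma opnorm_le1P (R : realType) (n : nat) (S : 'M[R]_n) :
  opnorm S <= 1 <-> contraction S.
Proof.
split=> [S1 x|Sc].
  have [x0|x0] := eqVneq (dot x x) 0.
    by rewrite (dot_eq0 x0) mulmx0.
  have xp : 0 < dot x x by rewrite lt_neqAle eq_sym x0 dot_ge0.
  have lxp : 0 < l2norm x.
    by rewrite lt_neqAle l2norm_ge0 andbT eq_sym -sqrf_eq0 l2norm_sqr.
  set y := (l2norm x)^-1 *: x.
  have y1 : dot y y = 1.
    by rewrite !dot_linE -l2norm_sqr; field; rewrite gt_eqF.
  have : l2norm (S *m y) <= 1.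
    apply: le_trans S1; apply: ub_le_sup; first exact: opnorm_has_ubound.
    by exists y => //=; rewrite l2norm_le1 y1.
  rewrite l2norm_le1 -scalemxAr !dot_linE mulrA -invfM -expr2 l2norm_sqr.
  by rewrite mulrC ler_pdivrMr // mul1r.
apply: ge_sup.
  by exists (l2norm (S *m 0)), 0 => //=; rewrite l2norm_le1 dotE big1 // => i _; rewrite mxE mul0r.
by move=> _ [x /= x1 <-]; apply: le_trans x1; rewrite l2norm_le.
Qed.

Lemma CSP (R : realType) (n : nat) (S : 'M[R]_n) :
  CS S <-> S^T = - S /\ contraction S.
Proof. by rewrite -opnorm_le1P. Qed.

(** * Orthogonal similarity and skew partial isometries *)

Lemma orthogonally_similar_sym (R : realType) (n : nat) (S S' : 'M[R]_n) :
  orthogonally_similar S S' -> orthogonally_similar S' S.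
Proof.
move=> [U [[UTU UUT] ->]]; exists U^T; split; first by rewrite /orthogonal_matrix trmxK.
by rewrite trmxK !mulmxA UUT mul1mx -mulmxA UUT mulmx1.
Qed.

Lemma orthogonally_similar_trans (R : realType) (n : nat) (A B C : 'M[R]_n) :
  orthogonally_similar A B -> orthogonally_similar B C ->
  orthogonally_similar A C.
Proof.
move=> [U [[U1 U2] ->]] [V [[V1 V2] ->]]; exists (U *m V); split.
  split; rewrite trmx_mul mulmxA.
    by rewrite -[V^T *m _ *m _]mulmxA U1 mulmx1.
  by rewrite -[U *m _ *m _]mulmxA V2 mulmx1.
by rewrite trmx_mul !mulmxA.
Qed.

(** An intrinsic description of the orbit of the model, common to both parities: a real
    skew-symmetric matrix has even rank, so the kernel is zero for even [n] and a line for odd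
    [n]. *)
Definition corank1_skew_partial_isometry (R : realType) (n : nat)
    (S : 'M[R]_n) : Prop :=
  [/\ S^T = - S, S *m S *m S = - S & (n <= (\rank S).+1)%N].

Lemma skew_partial_isometry_similar (R : realType) (n : nat) (S S' : 'M[R]_n) :
  orthogonally_similar S S' -> corank1_skew_partial_isometry S ->
  corank1_skew_partial_isometry S'.
Proof.
move=> [U [[U1 U2] ->]] [SN S3 rS]; split.
- by rewrite !trmx_mul trmxK SN mulNmx mulmxN mulmxA.
- rewrite !mulmxA -[_ *m U *m U^T]mulmxA U2 mulmx1.
  rewrite -[_ *m U *m U^T]mulmxA U2 mulmx1.
  by rewrite -[U^T *m S *m S]mulmxA -[U^T *m _ *m S]mulmxA S3 mulmxN mulNmx.
- have [UU _] := mulmx1_unit U2.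
  rewrite mxrankMfree ?row_free_unit // -mxrank_tr trmx_mul trmxK.
  by rewrite mxrankMfree ?row_free_unit // mxrank_tr.
Qed.

(** In a rank one factorization [K = c *m r], skewness kills the diagonal entries [c_i r_i], and
    [K_ij^2 = - K_ij K_ji] is minus the product of two of them. *)
Lemma skew_rank_le1 (R : realType) (n : nat) (K : 'M[R]_n) :
  K^T = - K -> (\rank K <= 1)%N -> K = 0.
Proof.
move=> KN; have := mulmx_base K.
move: (col_base K) (row_base K); case: (\rank K) => [|[|//]] c r Kcr _.
  by rewrite -Kcr [c]thinmx0 mul0mx.
have KE i j : K i j = c i 0 * r 0 j by rewrite -Kcr mxE big_ord1.
have Kij i j : K i j = - K j i by rewrite -[in LHS](trmxK K) KN linearN mxE mxE.
have Kii i : c i 0 * r 0 i = 0 by have := Kij i i; rewrite KE; lra.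
apply/matrixP => i j; rewrite mxE; apply/eqP; rewrite -sqrf_eq0 expr2 {2}Kij !KE.
have -> : c i 0 * r 0 j * - (c j 0 * r 0 i) = - ((c i 0 * r 0 i) * (c j 0 * r 0 j)) by ring.
by rewrite Kii mul0r oppr0.
Qed.

(** * Vectors in right kernels *)

(** The columns of [cokermx A] span the right kernel of [A], and row space inclusion means that [B]
    kills them all. *)
Lemma not_submx_vector (R : realType) (p q n : nat)
    (A : 'M[R]_(p, n)) (B : 'M[R]_(q, n)) :
  ~~ (B <= A)%MS -> exists2 v : 'cV[R]_n, A *m v = 0 & B *m v != 0.
Proof.
rewrite submxE => BA.
have [j Bj] : exists j, B *m col j (cokermx A) != 0.
  apply/existsP; apply: contraNT BA; rewrite negb_exists => /forallP B0.
  apply/eqP/matrixP => i j; have := B0 j; rewrite negbK colE mulmxA -colE => /eqP.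
  by move/colP/(_ i); rewrite !mxE.
by exists (col j (cokermx A)) => //; rewrite colE mulmxA mulmx_coker mul0mx.
Qed.

Lemma normalize (R : realType) (n : nat) (v : 'cV[R]_n) :
  v != 0 -> exists2 a : R, a != 0 & dot (a *: v) (a *: v) = 1.
Proof.
move=> v0; have l0 : l2norm v != 0.
  by apply: contra v0 => /eqP l0; apply/eqP/dot_eq0; rewrite -l2norm_sqr l0 expr0n.
exists (l2norm v)^-1; first by rewrite invr_eq0.
by rewrite !dot_linE -l2norm_sqr; field.
Qed.

Lemma kernel_unit_vector (R : realType) (p n : nat) (A : 'M[R]_(p, n)) :
  (\rank A < n)%N -> exists2 v : 'cV[R]_n, A *m v = 0 & dot v v = 1.
Proof.
move=> rA; have [|v Av] := @not_submx_vector R p n n A 1%:M.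
  by apply: contraL rA => /mxrankS; rewrite mxrank1 -leqNgt.
rewrite mul1mx => /normalize [a _ av1]; exists (a *: v) => //.
by rewrite -scalemxAr Av scaler0.
Qed.

(** * Frobenius norm and midpoints *)

(** The squared Frobenius norm, written as a trace so that orthogonal invariance is cyclicity. *)
Definition frob (R : realType) (n : nat) (A : 'M[R]_n) : R := \tr (A^T *m A).

Lemma frob_eq0 (R : realType) (n : nat) (A : 'M[R]_n) :
  frob A = 0 -> A = 0.
Proof.
have frobE : frob A = \sum_j dot (col j A) (col j A).
  rewrite /frob /mxtrace; apply: eq_bigr => j _.
  by rewrite dotE mxE; apply: eq_bigr => i _; rewrite !mxE.
move=> /eqP; rewrite frobE psumr_eq0; last by move=> j _; apply: dot_ge0.
move=> /allP A0; apply/matrixP => i j; rewrite mxE.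
have /(_ (mem_index_enum j)) /eqP /dot_eq0 := A0 j.
by move/colP/(_ i); rewrite !mxE.
Qed.

Lemma frob_similar (R : realType) (n : nat) (A B : 'M[R]_n) :
  orthogonally_similar A B -> frob B = frob A.
Proof.
move=> [U [[U1 U2] ->]]; rewrite /frob !trmx_mul trmxK mulmxA mxtrace_mulC.
by rewrite !mulmxA U2 mul1mx -[_ *m U *m U^T]mulmxA U2 mulmx1.
Qed.

Lemma frob_parallelogram (R : realType) (n : nat) (S E : 'M[R]_n) :
  frob (S + E) + frob (S - E) = (frob S + frob E) *+ 2.
Proof.
rewrite /frob [(S + E)^T]linearD [(S - E)^T]linearB /=.
rewrite !(mulmxDl, mulmxDr, mulmxN, mulNmx, opprK) !(mxtraceD, raddfN) /=; ring.
Qed.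

(* [S] is the midpoint of [S + E] and [S - E]; both being orthogonally similar
   to [S], strict convexity of the Frobenius norm kills [E]. *)
Lemma cstar_extreme_midpoint (R : realType) (n : nat) (K : set 'M[R]_n) S E :
  cstar_extreme K S -> K (S + E) -> K (S - E) -> E = 0.
Proof.
(* The coefficients are [a I] twice, with [a^2 = 1/2]: they are invertible and their squares add up
   to the identity. *)
move=> [_ Sext] KD KB; pose a : R := Num.sqrt 2^-1.
have a2 : a * a = 2^-1 by rewrite -expr2 sqr_sqrtr ?invr_ge0.
have a0 : a != 0.
  by apply/eqP => a0; move: a2; rewrite a0 mul0r => /eqP; rewrite eq_sym invr_eq0 pnatr_eq0.
pose T (_ : 'I_2) : 'M[R]_n := a%:M.
pose F (j : 'I_2) := if j == 0 then S + E else S - E.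
have sim : forall j, orthogonally_similar (F j) S.
  apply: (Sext 2%N T F).
  - by move=> j; rewrite /F; case: ifP.
  - by move=> j; rewrite unitmxE det_scalar unitrX // unitfE.
  - rewrite big_ord_recl big_ord1 /T tr_scalar_mx -scalar_mxM -raddfD /=.
    by congr (_%:M); rewrite a2; field.
  - rewrite big_ord_recl big_ord1 /T /F /= tr_scalar_mx.
    rewrite !mul_scalar_mx !mul_mx_scalar !scalerA a2 -scalerDr.
    rewrite addrACA subrr addr0 -mulr2n -scaler_nat scalerA mulVf ?scale1r //.
    by rewrite pnatr_eq0.
have /frob_similar f0 := sim 0; have /frob_similar f1 := sim 1.
move: f0 f1; rewrite /F /= => f0 f1.
by apply: frob_eq0; have := frob_parallelogram S E; rewrite -f0 -f1; lra.
Qed.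

(** * Necessary conditions for extremality *)

Lemma contraction_cubic_add (R : realType) (n : nat) (S : 'M[R]_n) :
  S^T = - S -> contraction S ->
  contraction (S + 2^-1 *: (S + S *m S *m S)).
Proof.
move=> SN Sc x; rewrite mulmxDl -scalemxAl mulmxDl -!mulmxA.
set p := S *m x; set q := S *m p; set r := S *m q.
have xq : dot x q = - dot p p by have := dot_skewl x p SN; rewrite -/p -/q; lra.
have qq : dot q q = - dot p r by have := dot_skewl p q SN; rewrite -/q -/r; lra.
(* For [y = x + q] one has [S y = p + r]; with [|S y|^2 <= |y|^2] and [|p + r|^2 >= 0], the quantity
   [|y|^2 - |S y|^2 / 4] is nonnegative. *)
have xE := Sc (x + q); move: xE; rewrite mulmxDr -/p -/r.
rewrite !dot_linE !(dotC q x) !(dotC r p) xq qq.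
have := dot_ge0 (p + r); rewrite !dot_linE !(dotC r p); lra.
Qed.

(** The matrix is [(S - S^3) / 2], the average of the contractions [S] and [- S^3]. *)
Lemma contraction_cubic_sub (R : realType) (n : nat) (S : 'M[R]_n) :
  contraction S -> contraction (S - 2^-1 *: (S + S *m S *m S)).
Proof.
move=> Sc x; rewrite mulmxBl -scalemxAl mulmxDl -!mulmxA.
set p := S *m x; set q := S *m p; set r := S *m q.
have := Sc x; have := Sc p; have := Sc q; rewrite -/p -/q -/r.
have := dot_ge0 (p + r); rewrite !dot_linE !(dotC r p); lra.
Qed.

Lemma cstar_extreme_cube (R : realType) (n : nat) (S : 'M[R]_n) :
  cstar_extreme (@CS R n) S -> S *m S *m S = - S.
Proof.
move=> Sext; have /CSP[SN Sc] := Sext.1.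
have S3N : (S *m S *m S)^T = - (S *m S *m S).
  by rewrite !trmx_mul SN !(mulNmx, mulmxN) opprK mulmxA.
have EN : (2^-1 *: (S + S *m S *m S))^T = - (2^-1 *: (S + S *m S *m S)).
  by rewrite linearZ linearD /= SN S3N -opprD scalerN.
suff /eqP : 2^-1 *: (S + S *m S *m S) = 0.
  rewrite scaler_eq0 invr_eq0 pnatr_eq0 /= addrC addr_eq0 => /eqP //.
apply: (cstar_extreme_midpoint Sext); apply/CSP; split.
- by rewrite [LHS]linearD /= EN SN -opprD.
- exact: contraction_cubic_add.
- by rewrite [LHS]linearB /= EN SN -opprD.
- exact: contraction_cubic_sub.
Qed.

(** By skewness the range of [S] is orthogonal to [u] and [v], so the two terms act into orthogonal
    spaces. The condition [a ^+ 2 = 1] covers both signs of the perturbation. *)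
Lemma contraction_kernel_rotation (R : realType) (n : nat) (S : 'M[R]_n) u v a :
  S^T = - S -> contraction S -> S *m u = 0 -> S *m v = 0 ->
  dot u u = 1 -> dot v v = 1 -> dot u v = 0 -> a ^+ 2 = 1 ->
  contraction (S + a *: (u *m v^T - v *m u^T)).
Proof.
move=> SN Sc Su Sv uu vv uv a1 x; rewrite mulmxDl -scalemxAl mulmxBl -!mulmxA.
have outer (w z : 'cV[R]_n) : w *m (z^T *m x) = dot z x *: w.
  by rewrite [z^T *m x]mx11_scalar mul_mx_scalar.
rewrite !outer.
have Sxu : dot u (S *m x) = 0.
  by rewrite dotC dot_skewl // Su dot0r oppr0.
have Sxv : dot v (S *m x) = 0.
  by rewrite dotC dot_skewl // Sv dot0r oppr0.
(* Removing from [x] its projection on the plane of [u], [v] leaves [S x] unchanged; this frees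
   [(u.x)^2 + (v.x)^2], exactly the squared norm of the added term. *)
have := Sc (x - dot u x *: u - dot v x *: v).
rewrite !mulmxBr -!scalemxAr Su Sv !scaler0 !subr0.
rewrite !dot_linE !(dotC v u) !(dotC (S *m x)) !(dotC x) Sxu Sxv uu vv uv.
move: (dot u x) (dot v x) => b c.
nra.
Qed.

Lemma cstar_extreme_rank (R : realType) (n : nat) (S : 'M[R]_n) :
  cstar_extreme (@CS R n) S -> (n <= (\rank S).+1)%N.
Proof.
move=> Sext; have /CSP[SN Sc] := Sext.1.
rewrite leqNgt; apply/negP => rS.
have [u Su uu] := kernel_unit_vector (ltnW rS).
(* Appending the row [u^T] to [S] raises the rank by at most one, which stays below [n]; the kernel
   then yields [v] in [ker S] orthogonal to [u]. *)
have [|v /eqP] := @kernel_unit_vector R _ n (col_mx S u^T).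
  apply: leq_ltn_trans rS; rewrite -addsmxE.
  apply: leq_trans (mxrank_adds_leqif _ _).1 _.
  by rewrite -[leqRHS]addn1 leq_add2l rank_leq_row.
rewrite mul_col_mx -[0]vsubmxK /= => /eqP.
move=> /eq_col_mx [Sv uv] vv.
have {Sv}Sv : S *m v = 0 by rewrite Sv; apply/colP => i; rewrite !mxE.
have {uv}uv : dot u v = 0 by rewrite /dot uv !mxE.
have E0 : u *m v^T - v *m u^T = 0.
  have EN : (u *m v^T - v *m u^T)^T = - (u *m v^T - v *m u^T).
    by rewrite linearB /= !trmx_mul !trmxK opprB.
  apply: (cstar_extreme_midpoint Sext); apply/CSP; split.
  - by rewrite [LHS]linearD /= EN SN -opprD.
  - by rewrite -[_ - v *m _]scale1r; apply: contraction_kernel_rotation; rewrite ?expr1n.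
  - by rewrite [LHS]linearB /= EN SN -opprD.
  - by rewrite -scaleN1r; apply: contraction_kernel_rotation; rewrite ?sqrrN ?expr1n.
(* The perturbation sends [v] to [u], so it is not zero. *)
have : dot u ((u *m v^T - v *m u^T) *m v) = 1.
  rewrite mulmxBl -!mulmxA [v^T *m v]mx11_scalar [u^T *m v]mx11_scalar.
  by rewrite !mul_mx_scalar -!/(dot _ _) !dot_linE uu uv vv; lra.
by rewrite E0 mul0mx dot0r => /eqP; rewrite eq_sym oner_eq0.
Qed.

(** * Rigidity of C*-convex combinations *)

Lemma cstar_combination_intertwine (R : realType) (n k : nat) (S : 'M[R]_n)
    (T Sj : 'I_k -> 'M[R]_n) :
  S^T = - S -> S *m S *m S = - S -> (forall j, contraction (Sj j)) ->
  \sum_(j < k) (T j)^T *m T j = 1%:M ->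
  S = \sum_(j < k) (T j)^T *m Sj j *m T j ->
  forall j, Sj j *m T j *m S = T j *m S *m S.
Proof.
move=> SN S3 Sjc T1 SE j.
suff H (x : 'cV[R]_n) : Sj j *m T j *m S *m x = T j *m S *m S *m x.
  by apply/matrixP => a b; have /colP/(_ a) := H (delta_mx b 0); rewrite -!colE !mxE.
set w := S *m x.
(* On its range [S] squares to [-1], hence is isometric there. *)
have SSw : S *m (S *m w) = - w by rewrite /w !mulmxA S3 mulNmx.
have ww : dot w w = dot (S *m w) (S *m w).
  by rewrite dot_skewl // SSw dotNr opprK.
pose d i := Sj i *m T i *m w - T i *m (S *m w).
(* Expand the square and bound [|S_i T_i w|^2] by [|T_i w|^2]. *)
have d2 i : dot (d i) (d i) <=
    dot w ((T i)^T *m T i *m w) - 2 * dot (S *m w) ((T i)^T *m Sj i *m T i *m w)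
    + dot (S *m w) ((T i)^T *m T i *m (S *m w)).
  have := Sjc i (T i *m w).
  rewrite /d !dot_linE -!mulmxA -!(dot_mull (T i)).
  rewrite !(dotC (Sj i *m _) (T i *m (S *m w))); lra.
(* The two sum hypotheses turn the total bound into [|w|^2 - 2 |S w|^2 + |S w|^2], which vanishes by
   the isometry. *)
have sum0 : \sum_i dot (d i) (d i) <= 0.
  apply: le_trans (ler_sum _ (fun i _ => d2 i)) _.
  rewrite big_split sumrB /= -mulr_sumr -!dot_sumr -!mulmx_suml T1 -SE.
  by rewrite !mul1mx ww; lra.
have /eqP : \sum_i dot (d i) (d i) = 0.
  by apply/eqP; rewrite eq_le sum0 sumr_ge0 // => i _; apply: dot_ge0.
rewrite psumr_eq0; last by move=> i _; apply: dot_ge0.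
move=> /allP /(_ j (mem_index_enum j)) /eqP /dot_eq0 /eqP.
by rewrite /d subr_eq0 /w !mulmxA => /eqP.
Qed.

Lemma cstar_combination_rigid (R : realType) (n k : nat) (S : 'M[R]_n)
    (T Sj : 'I_k -> 'M[R]_n) :
  corank1_skew_partial_isometry S -> (forall j, CS (Sj j)) ->
  (forall j, T j \in unitmx) ->
  \sum_(j < k) (T j)^T *m T j = 1%:M ->
  S = \sum_(j < k) (T j)^T *m Sj j *m T j ->
  forall j, corank1_skew_partial_isometry (Sj j).
Proof.
move=> [SN S3 rS] SjCS Tu T1 SE j.
have SjE := cstar_combination_intertwine SN S3 (fun j => (iffLR (CSP _) (SjCS j)).2) T1 SE j.
have /CSP[SjN _] := SjCS j.
have rTM (A : 'M[R]_n) : \rank (T j *m A) = \rank A by rewrite eqmxMfull // row_full_unit.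
have rT : (n <= (\rank (T j *m S)).+1)%N by rewrite rTM.
split=> //.
  set K := Sj j *m Sj j *m Sj j + Sj j.
  suff /eqP : K = 0 by rewrite addr_eq0 => /eqP.
  apply: skew_rank_le1.
    by rewrite /K linearD /= !trmx_mul SjN !(mulNmx, mulmxN) opprK mulmxA opprD.
  (* Each use of [SjE] trades a factor [S_j] on the left for a factor [S] on the right, so the
     product is [T_j (S^4 + S^2) = 0]. *)
  have KT : K *m (T j *m S) = 0.
    rewrite /K mulmxDl -!mulmxA [Sj j *m (T j *m S)]mulmxA SjE.
    rewrite -!mulmxA [Sj j *m (T j *m _)]mulmxA [Sj j *m T j *m _]mulmxA SjE.
    rewrite -!mulmxA [Sj j *m (T j *m _)]mulmxA [Sj j *m T j *m _]mulmxA SjE.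
    by rewrite -!mulmxA [S *m (S *m S)]mulmxA S3 !mulmxN addrC subrr.
  (* Sylvester's inequality: [K] and [T_j S] have ranks adding up to at most [n], and the second is
     at least [n - 1]. *)
  have := mxrank_mul_min K (T j *m S); rewrite KT mxrank0.
  by rewrite leqn0 subn_eq0 => h; move: (leq_trans h rT); rewrite addnC -addn1 leq_add2l.
(* The rank bound passes to [S_j] through [T_j S^2 = S_j T_j S], since [S^2] has the rank of [S]. *)
have rS2 : (\rank S <= \rank (S *m S))%N.
  by rewrite -[X in (X <= _)%N]mxrank_opp -S3 mxrankM_maxl.
apply: leq_trans rS _; rewrite ltnS (leq_trans rS2) // -rTM mulmxA -SjE -mulmxA.
exact: mxrankM_maxl.
Qed.

(** * Orthonormal bases adapted to the model *)

(* The columns of [X] and of [- S X] form a symplectic orthonormal family. *)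
Lemma symplectic_family (R : realType) (n m : nat) (S : 'M[R]_n) :
  corank1_skew_partial_isometry S -> (m + m <= n)%N ->
  exists X : 'M[R]_(n, m),
    [/\ X^T *m X = 1%:M, X^T *m S *m X = 0 & S *m S *m X = - X].
Proof.
move=> [SN S3 rS]; elim: m => [_|m IHm mn].
  by exists 0; split; rewrite ?mulmx0 ?oppr0 //; apply/matrixP => -[].
have [|X [X1 XSX SSX]] := IHm; first lia.
(* Look for [v] orthogonal to [X] and [S X] with [S v] nonzero. These are [2m] conditions, while [S]
   has rank at least [n - 1 >= 2m + 1]. *)
have [|v] := @not_submx_vector R _ _ n (col_mx X^T (X^T *m S)) S.
  apply/negP => /mxrankS h.
  by have := leq_trans h (rank_leq_row _); lia.
rewrite mul_col_mx -[0]vsubmxK => /eq_col_mx [Xv XSv] Sv.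
have {Xv}Xv : X^T *m v = 0 by rewrite Xv; apply/colP => i; rewrite !mxE.
have {XSv}XSv : X^T *m S *m v = 0 by rewrite XSv; apply/colP => i; rewrite !mxE.
(* The new vector is taken in the range of [S], where [S^2 = -1]. *)
have [a _ xx] := normalize Sv; set x := a *: (S *m v) in xx.
have Xx : X^T *m x = 0 by rewrite /x -scalemxAr mulmxA XSv scaler0.
have XSS : X^T *m S *m S = - X^T.
  by rewrite -[RHS]linearN /= -SSX !trmx_mul SN !(mulmxN, mulNmx) opprK mulmxA.
have XSx : X^T *m S *m x = 0.
  by rewrite /x -scalemxAr mulmxA XSS mulNmx Xv oppr0 scaler0.
have SSx : S *m S *m x = - x.
  by rewrite /x -scalemxAr !mulmxA S3 mulNmx scalerN.
rewrite -[m.+1]/(1 + m)%N; exists (row_mx x X); split.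
- rewrite tr_row_mx mul_col_row X1 Xx -[x^T *m X]trmxK trmx_mul trmxK Xx trmx0.
  by rewrite [x^T *m x]mx11_scalar -/(dot x x) xx -scalar_mx_block.
- rewrite tr_row_mx mul_col_mx mul_col_row XSX XSx.
  have -> : x^T *m S *m X = 0.
    apply: trmx_inj; rewrite !trmx_mul trmxK SN mulNmx mulmxN mulmxA XSx.
    by rewrite oppr0 trmx0.
  rewrite -[x^T *m S *m x]mulmxA [x^T *m _]mx11_scalar -/(dot x _) skew_dot0 //.
  by rewrite raddf0 block_mx0.
- by rewrite mul_mx_row SSX SSx opp_row_mx.
Qed.

(** The sign in [- (S *m X)] matches the model: [S] maps this second block back to [X], and [X] to
    minus the second block. *)
Lemma symplectic_family_gram (R : realType) (n m : nat) (S : 'M[R]_n)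
    (X : 'M[R]_(n, m)) :
  S^T = - S ->
  X^T *m X = 1%:M -> X^T *m S *m X = 0 -> S *m S *m X = - X ->
  let U := row_mx X (- (S *m X)) in
  U^T *m U = 1%:M /\ S *m U = U *m symplectic_block R m.
Proof.
move=> SN X1 XSX SSX U; split.
  rewrite /U tr_row_mx mul_col_row [(- _)^T]linearN /= trmx_mul SN.
  rewrite !(mulmxN, mulNmx, opprK) !mulmxA X1 XSX -[X^T *m S *m S *m X]mulmxA.
  by rewrite -[X^T *m S *m _]mulmxA [S *m (S *m X)]mulmxA SSX mulmxN X1 !oppr0 opprK -scalar_mx_block.
rewrite /U /symplectic_block mul_row_block mul_mx_row.
by rewrite !(mulmx0, mulmxN, mulmx1, mulmxA, opprK) SSX opprK addr0 add0r.
Qed.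

Lemma mulmx1C_eq (R : realType) (n p : nat) (pn : p = n)
    (A : 'M[R]_(p, n)) (B : 'M[R]_(n, p)) :
  A *m B = 1%:M -> B *m A = 1%:M.
Proof. by case: n / pn A B => A B; apply: mulmx1C. Qed.

(** The columns of [U] are an orthonormal basis in which [S] has matrix [B]; eliminating [pn] makes
    [U] square, hence orthogonal. *)
Lemma orthogonally_similar_castmx (R : realType) (n p : nat) (pn : p = n)
    (S : 'M[R]_n) (U : 'M[R]_(n, p)) (B : 'M[R]_p) :
  U^T *m U = 1%:M -> S *m U = U *m B ->
  orthogonally_similar S (castmx (pn, pn) B).
Proof.
case: n / pn S U => S U U1 SU; exists U; rewrite castmx_id; split.
  by split=> //; apply: mulmx1C.
by rewrite -mulmxA SU mulmxA U1 mul1mx.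
Qed.

Lemma orthogonally_similar_even_model (R : realType) (n : nat)
    (n_even : ~~ odd n) (S : 'M[R]_n) :
  corank1_skew_partial_isometry S ->
  orthogonally_similar S (even_model R n_even).
Proof.
move=> Sg; have [SN _ _] := Sg.
have [|X [X1 XSX SSX]] := @symplectic_family R n n./2 S Sg; first by rewrite even_size.
have [U1 SU] := symplectic_family_gram SN X1 XSX SSX.
exact: orthogonally_similar_castmx U1 SU.
Qed.

Lemma orthogonally_similar_odd_model (R : realType) (n : nat)
    (n_odd : odd n) (S : 'M[R]_n) :
  corank1_skew_partial_isometry S ->
  orthogonally_similar S (odd_model R n_odd).
Proof.
move=> Sg; have [SN _ _] := Sg; have nE := odd_size n_odd.
have [|X [X1 XSX SSX]] := @symplectic_family R n n.-1./2 S Sg; first lia.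
have [U1 SU] := symplectic_family_gram SN X1 XSX SSX.
move: (row_mx _ _) U1 SU => U U1 SU.
(* [U] has [n - 1] columns; a unit vector orthogonal to them completes the basis. *)
have [|z Uz zz] := @kernel_unit_vector R _ n U^T.
  by apply: leq_ltn_trans (rank_leq_row _) _; lia.
have zU : z^T *m U = 0 by rewrite -[LHS]trmxK trmx_mul trmxK Uz trmx0.
have V1 : (row_mx z U)^T *m row_mx z U = 1%:M.
  rewrite tr_row_mx mul_col_row U1 Uz zU [z^T *m z]mx11_scalar -/(dot z z) zz.
  by rewrite -scalar_mx_block.
have USz : U^T *m (S *m z) = 0.
  have -> : U^T *m (S *m z) = - ((S *m U)^T *m z).
    by rewrite trmx_mul SN mulmxN mulNmx opprK mulmxA.
  by rewrite SU trmx_mul -mulmxA Uz mulmx0 oppr0.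
have zSz : z^T *m (S *m z) = 0.
  by rewrite [LHS]mx11_scalar -/(dot z _) skew_dot0 // raddf0.
(* [S z] is orthogonal to [U], whose span is [S]-invariant, and to [z], by skewness; so it is zero,
   which gives the zero block. *)
have Sz : S *m z = 0.
  have V2 := mulmx1C_eq nE V1.
  by rewrite -[LHS]mul1mx -V2 -mulmxA tr_row_mx mul_col_mx USz zSz col_mx0 mulmx0.
apply: orthogonally_similar_castmx V1 _.
by rewrite mul_mx_row mul_row_block Sz SU !mulmx0 addr0 add0r.
Qed.

(** * Properties of the models *)

Lemma corank1_skew_partial_isometry_castmx (R : realType) (n p : nat)
    (pn : p = n) (B : 'M[R]_p) :
  corank1_skew_partial_isometry B ->
  corank1_skew_partial_isometry (castmx (pn, pn) B).
Proof. by case: n / pn; rewrite castmx_id. Qed.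

Lemma symplectic_block_skew (R : realType) (m : nat) :
  (symplectic_block R m)^T = - symplectic_block R m.
Proof.
by rewrite tr_block_mx opp_block_mx !trmx0 linearN /= trmx1 oppr0 opprK.
Qed.

Lemma symplectic_block_sqr (R : realType) (m : nat) :
  symplectic_block R m *m symplectic_block R m = - 1%:M.
Proof.
rewrite mulmx_block !(mulmx0, mul0mx, mulmx1, mul1mx, addr0, add0r).
by rewrite scalar_mx_block opp_block_mx oppr0.
Qed.

Lemma castmx_sqrN1 (R : realType) (n p : nat) (pn : p = n) (B : 'M[R]_p) :
  B *m B = - 1%:M ->
  castmx (pn, pn) B *m castmx (pn, pn) B = - 1%:M.
Proof. by case: n / pn; rewrite castmx_id. Qed.

Lemma skew_orthogonal_corank1 (R : realType) (n : nat) (S : 'M[R]_n) :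
  S^T = - S -> S *m S = - 1%:M -> corank1_skew_partial_isometry S.
Proof.
move=> SN S2; split=> //; first by rewrite S2 mulNmx mul1mx.
rewrite mxrank_unit ?leqnSn //.
have /mulmx1_unit[] // : S *m (- S) = 1%:M by rewrite mulmxN S2 opprK.
Qed.

Lemma even_model_corank1 (R : realType) (n : nat) (n_even : ~~ odd n) :
  corank1_skew_partial_isometry (even_model R n_even).
Proof.
apply: corank1_skew_partial_isometry_castmx; apply: skew_orthogonal_corank1.
  exact: symplectic_block_skew.
exact: symplectic_block_sqr.
Qed.

Lemma odd_model_corank1 (R : realType) (n : nat) (n_odd : odd n) :
  corank1_skew_partial_isometry (odd_model R n_odd).
Proof.
apply: corank1_skew_partial_isometry_castmx.
have [JN J3 _] := skew_orthogonal_corank1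
  (symplectic_block_skew R n.-1./2) (symplectic_block_sqr R n.-1./2).
have J_unit : symplectic_block R n.-1./2 \in unitmx.
  apply: (mulmx1_unit (B := - symplectic_block R n.-1./2) _).1.
  by rewrite mulmxN symplectic_block_sqr opprK.
move: (symplectic_block R _) JN J3 J_unit => J JN J3 J_unit; split.
- by rewrite tr_block_mx opp_block_mx JN !trmx0 !oppr0.
- by rewrite !mulmx_block opp_block_mx !(mulmx0, mul0mx, addr0, add0r, oppr0) J3.
- by rewrite rank_diag_block_mx mxrank0 add0n add1n ltnS mxrank_unit.
Qed.

(** * Description of the C*-extreme points *)

(** Handles both parities at once. For the converse inclusion, rigidity makes every [S_j] similar to
    [M], hence to [S]. *)
Lemma cstar_extreme_CS (R : realType) (n : nat) (M : 'M[R]_n) :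
  corank1_skew_partial_isometry M ->
  (forall S : 'M[R]_n, corank1_skew_partial_isometry S ->
     orthogonally_similar S M) ->
  cstar_extreme (@CS R n) = [set S | CS S /\ orthogonally_similar S M].
Proof.
move=> Mg Mmodel; apply/seteqP; split=> S /=.
  move=> Sext; split; first exact: Sext.1.
  apply: Mmodel; split; last exact: cstar_extreme_rank.
    by have [] := Sext.1.
  exact: cstar_extreme_cube.
move=> [SCS SM]; split=> // k T Sj SjCS Tu T1 SE j.
have Sg := skew_partial_isometry_similar (orthogonally_similar_sym SM) Mg.
apply: orthogonally_similar_trans (orthogonally_similar_sym SM).
exact: Mmodel (cstar_combination_rigid Sg SjCS Tu T1 SE j).
Qed.

Theorem corollary4p14 (R : realType) (n : nat) (n_gt0 : (0 < n)%N) :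
  (forall n_odd : odd n,
     cstar_extreme (@CS R n) =
       [set S | CS S /\ orthogonally_similar S (odd_model R n_odd)])
  /\
  (forall n_even : ~~ odd n,
     cstar_extreme (@CS R n) =
       [set S | CS S /\ orthogonally_similar S (even_model R n_even)]
     /\
     [set S | CS S /\ orthogonally_similar S (even_model R n_even)] =
       [set S : 'M[R]_n | S^T = - S /\ orthogonal_matrix S]).
Proof.
split=> [n_odd|n_even].
  apply: cstar_extreme_CS; first exact: odd_model_corank1.
  exact: orthogonally_similar_odd_model.
split.
  apply: cstar_extreme_CS; first exact: even_model_corank1.
  exact: orthogonally_similar_even_model.
apply/seteqP; split=> S /=.
  (* The identity [M^2 = -1] passes from the model to [S]; with [S^T = - S] it says that [S] is
     orthogonal. *)
  move=> [[SN _] /orthogonally_similar_sym [U [[U1 U2] SE]]]; split=> //.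
  have M2 : even_model R n_even *m even_model R n_even = - 1%:M.
    exact: castmx_sqrN1 (symplectic_block_sqr R _).
  have S2 : S *m S = - 1%:M.
    rewrite SE !mulmxA -[_ *m U *m U^T]mulmxA U2 mulmx1 -[U^T *m _ *m _]mulmxA.
    by rewrite M2 mulmxN mulNmx mulmx1 U1.
  by rewrite /orthogonal_matrix SN mulNmx mulmxN S2 opprK.
(* An orthogonal matrix preserves norms, and skewness turns [S^T S = 1] into [S^2 = -1]. *)
move=> [SN [STS _]]; split.
  apply/CSP; split=> // x.
  by rewrite dot_mull mulmxA STS mul1mx.
apply: orthogonally_similar_even_model; apply: skew_orthogonal_corank1 => //.
by rewrite -STS SN mulNmx opprK.
Qed.
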